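(* Let $p>1$ and let $u$ be a positive ancient solution of the porous media equation $u_t=\Delta(u^p)$ on $\mathbb{R}$ (that is, $u_t=(u^p)_{xx}$) such that $$u(x,t)=o\left(d(x)^{1/(p-1)}+|t|^{1/(p-1)}\right)\quad\text{near infinity}.$$ Then $u$ is a constant.
   Context: An ancient solution is a solution defined in all space and all negative time, i.e. on $\mathbb{R}\times(-\infty,0)$. A positive solution is a positive function, smooth enough to be a classical solution, satisfying the equation pointwise. $d(x)$ is the distance from $x$ to a fixed base point of $\mathbb{R}$ (e.g. $d(x)=|x|$), and ''near infinity'' means as $d(x)+|t|\to\infty$. *)

(* Defs.v *)
From Stdlib Require Import Reals.
From Coquelicot Require Import Coquelicot.
Open Scope R_scope.

(* Real power of a nonnegative base. [Rpower 0 a] is [1], since [ln 0 = 0] in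
   Stdlib; here [0 ^ a = 0], the intended value for [a > 0]. *)
Definition rpow (r a : R) : R := if Rlt_dec 0 r then Rpower r a else 0.

(* Functions on R x (-oo,0) are represented by total functions [u x t]; their
   values for [t >= 0] are never constrained. *)

Definition dt (u : R -> R -> R) (x t : R) : R := Derive (fun s => u x s) t.
Definition dx (u : R -> R -> R) (x t : R) : R := Derive (fun y => u y t) x.
Definition dxx (u : R -> R -> R) : R -> R -> R := dx (dx u).

Definition continuous2 (f : R -> R -> R) (x t : R) : Prop :=
  continuous (fun z : R * R => f (fst z) (snd z)) (x, t).

(* The classical space C^{2,1}: u, u_t, u_x, u_xx exist and are jointly
   continuous on R x (-oo,0). *)
Definition C21_ancient (u : R -> R -> R) : Prop :=
  forall x t : R, t < 0 ->
    ex_derive (fun s => u x s) t /\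
    ex_derive (fun y => u y t) x /\
    ex_derive (fun y => dx u y t) x /\
    continuous2 u x t /\
    continuous2 (dt u) x t /\
    continuous2 (dx u) x t /\
    continuous2 (dxx u) x t.

Definition positive_ancient_solution_PME (p : R) (u : R -> R -> R) : Prop :=
  C21_ancient u /\
  (forall x t : R, t < 0 -> 0 < u x t) /\
  (forall x t : R, t < 0 ->
     dt u x t = dxx (fun y s => Rpower (u y s) p) x t).

(* u = o(g) as d(x) + |t| -> oo within R x (-oo,0), where d(x) = |x - x0|. *)
Definition little_o_near_infinity (x0 : R) (u g : R -> R -> R) : Prop :=
  forall eps : R, 0 < eps ->
    exists M : R, forall x t : R, t < 0 ->
      M < Rabs (x - x0) + Rabs t ->
      Rabs (u x t) <= eps * Rabs (g x t).

(* Main.v *)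
(* The pressure v = p/(p-1) u^(p-1) solves v_t = (p-1) v v_xx + v_x^2, and the
   growth hypothesis says v = o(|x| + |t|). This equation is invariant under
   v(x,t) -> v(Rx, Rt)/R, which preserves v_x, so on the unit box the rescaled
   pressure is bounded by any prescribed d > 0 once R is large. A
   Bernstein-type estimate bounds v_x at the centre of the box by a quantity
   tending to 0 with d: for w = v + v^2/(2d), the equation of w_x contains a
   damping term of order - w_x^3/d, so w_x stays below a barrier that blows up
   on the parabolic boundary. Hence v_x = 0 everywhere, u depends on t only,
   and the equation gives u_t = 0. *)

Require Import Defs.
From Stdlib Require Import Reals Lra IndefiniteDescription.
From Coquelicot Require Import Coquelicot.
Open Scope R_scope.

(** * Algebra of the damping term *)

(** Differentiating the pressure equation directly gives [(v_x)_t = m v (v_x)_xx + (m + 2) v_x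
    v_xx], which has no term of order zero in [v_x]: a maximum principle alone then yields no
    interior bound. The quadratic change of variable is there to create one. The other obstacle is
    degeneracy: the diffusion coefficient [m v] has no positive lower bound. Only [v <= d] enters,
    because the barrier is convex in [x] and its diffusion term can be bounded with [d] in place of
    [v]. The barrier has size [l]. Where it touches, put [y = z / l]: its time derivative, its
    diffusion and its transport terms are all at most a constant times [l * y ^ 3], while the
    damping is [l ^ 3 * y ^ 3 / (8 * d)]. This is the origin of the condition [16 * d * (1 + 2 * m *
    d + (2 + 3 * m) * l) <= l ^ 2], which for fixed [l] holds as soon as [d] is small. The resulting
    bound [3 * l] is the value of the barrier at the centre. *)

Lemma Rsqr_lower_bound (X z e : R) : 0 < z -> Rabs (X - z) <= e -> z * z - 2 * z * e <= X * X.
Proof.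
  intros Hz He. apply Rabs_le_between in He. destruct (Rle_lt_dec e z); [|nra].
  assert (0 <= (X - (z - e)) * (X + (z - e))) by (apply Rmult_le_pos; lra). nra.
Qed.

(* With [w = v + v^2 / (2 d)] and [0 < v <= d], the pressure equation
   [v_t = m v v_xx + v_x^2] becomes [w_t = m v w_xx + drift(v) w_x^2]. The point
   of the change of variable is that [drift] is strictly decreasing in [v], so
   that differentiating in [x] produces a damping term of order [- w_x^3 / d]. *)
Definition drift (m d v : R) : R :=
  (1 - m) * (/ (1 + v / d)) + m * (/ (1 + v / d)) * (/ (1 + v / d)).

Lemma drift_factor_bounds (d v : R) : 0 < d -> 0 < v <= d -> / 2 <= / (1 + v / d) <= 1.
Proof.
  intros Hd Hv.
  assert (0 <= v / d) by (apply Rdiv_le_0_compat; lra).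
  assert (v / d <= 1) by (apply Rle_div_l; lra).
  split.
  - apply Rinv_le_contravar; lra.
  - rewrite <- Rinv_1. apply Rinv_le_contravar; lra.
Qed.

(** With [s], [S] the factors [1 / (1 + v / d)] at [v] and [V], the difference is
    [(S - s) * (1 + m * (S + s - 1))]. Since [v, V <= d], both factors are at least 1/2, so the
    bracket is at least 1 for every [m > 0], and [S * s >= 1 / 4] gives the constant [4 * d]. *)
Lemma drift_decrease (m d v V : R) : 0 < m -> 0 < d -> 0 < v <= d -> 0 < V <= d -> v <= V ->
  drift m d V - drift m d v <= - ((V - v) / (4 * d)).
Proof.
  intros Hm Hd Hv HV HvV. unfold drift.
  pose proof (drift_factor_bounds d v Hd Hv) as Hs.
  pose proof (drift_factor_bounds d V Hd HV) as HS.
  assert (E : / (1 + V / d) - / (1 + v / d) = - ((V - v) / d) * (/ (1 + V / d) * / (1 + v / d))).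
  { field. lra. }
  set (s := / (1 + v / d)) in *. set (S := / (1 + V / d)) in *.
  assert (Hq : 0 <= (V - v) / d) by (apply Rdiv_le_0_compat; lra).
  replace ((V - v) / (4 * d)) with ((V - v) / d / 4) by (field; lra).
  set (q := (V - v) / d) in *.
  assert (HSs : / 4 <= S * s) by nra.
  assert (Hsub : S - s <= - (q / 4)) by (rewrite E; nra).
  assert (0 <= m * (S + s - 1)) by (apply Rmult_le_pos; lra).
  replace ((1 - m) * S + m * S * S - ((1 - m) * s + m * s * s))
    with ((S - s) + (S - s) * (m * (S + s - 1))) by ring.
  nra.
Qed.

Lemma drift_bound (m d v : R) : 0 < m -> 0 < d -> 0 < v <= d -> Rabs (drift m d v) <= 1 + m.
Proof.
  intros Hm Hd Hv. unfold drift.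
  pose proof (drift_factor_bounds d v Hd Hv) as Hs.
  set (s := / (1 + v / d)) in *.
  replace ((1 - m) * s + m * s * s) with (s - m * (s * (1 - s))) by ring.
  assert (Hss : 0 <= s * (1 - s) <= 1) by nra.
  assert (0 <= m * (s * (1 - s)) <= m) by (split; nra).
  apply Rabs_le. split; lra.
Qed.

(* The capitals [V, W] stand for values at [x + h], lower case for values at
   [x]; [Zt, Zx, Zxx] are the derivatives of a barrier touching
   [z = (W - w) / h] from above, and [e] bounds the discretisation errors. *)
Lemma touching_inequality
  (m d h e v V wx Wx wxx Wxx wt Wt z Zt Zx Zxx : R) :
  0 < m -> 0 < d -> 0 < h -> 0 < z -> 0 <= Zxx ->
  0 < v <= d -> 0 < V <= d ->
  wt = m * v * wxx + drift m d v * wx ^ 2 ->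
  Wt = m * V * Wxx + drift m d V * Wx ^ 2 ->
  (V + V ^ 2 / (2 * d)) - (v + v ^ 2 / (2 * d)) = h * z ->
  h * Zt <= Wt - wt -> Wx - wx = h * Zx -> Wxx - wxx <= h * Zxx ->
  Rabs (wxx - Zx) <= e -> Rabs (Wx - z) <= e -> Rabs (wx - z) <= e ->
  Zt + z ^ 3 / (8 * d) <=
    m * d * Zxx + (2 + 3 * m) * z * Rabs Zx
    + e * (m * z + z ^ 2 / (4 * d) + 2 * (1 + m) * Rabs Zx).
Proof.
  intros Hm Hd Hh Hz HZxx Hv HV Hwt HWt HW Ht Hx Hxx He1 He2 He3.
  assert (He : 0 <= e) by (pose proof (Rabs_pos (wx - z)); lra).
  (* The increment of [w] factors as [(V - v) * (1 + c)] with [0 <= c <= 1], so the difference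
     quotients [q] of [v] and [z] of [w] agree up to a factor 2. *)
  set (q := (V - v) / h).
  assert (Hq : V - v = h * q) by (unfold q; field; lra).
  set (c := (V + v) / (2 * d)).
  assert (Hc : 0 <= c <= 1).
  { unfold c. split.
    - apply Rdiv_le_0_compat; lra.
    - apply Rle_div_l; lra. }
  assert (Hqz : q * (1 + c) = z).
  { apply (Rmult_eq_reg_l h); [|lra]. rewrite <- HW. unfold c.
    replace (h * (q * (1 + (V + v) / (2 * d)))) with (h * q * (1 + (V + v) / (2 * d))) by ring.
    rewrite <- Hq. field. lra. }
  assert (Hq0 : 0 < q) by nra.
  assert (Hq1 : z / 2 <= q <= z) by nra.
  assert (HvV : v <= V) by nra.
  pose proof (drift_decrease m d v V Hm Hd Hv HV HvV) as Hb.
  pose proof (drift_bound m d v Hm Hd Hv) as Hb1.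
  assert (S1 : h * Zt <= h * (m * d * Zxx + m * q * wxx - q / (4 * d) * Wx ^ 2
      + drift m d v * (Wx + wx) * Zx)).
  { eapply Rle_trans; [exact Ht|]. rewrite HWt, Hwt.
    (* Discrete product rule: the four terms are diffusion of [z], the variation of the diffusion
       coefficient, the damping, and transport. *)
    replace (m * V * Wxx + drift m d V * Wx ^ 2 - (m * v * wxx + drift m d v * wx ^ 2))
      with (m * V * (Wxx - wxx) + m * (V - v) * wxx + (drift m d V - drift m d v) * Wx ^ 2
        + drift m d v * (Wx + wx) * (Wx - wx)) by ring.
    rewrite Hx, Hq.
    assert (A1 : m * V * (Wxx - wxx) <= m * d * (h * Zxx)).
    { apply Rle_trans with (m * V * (h * Zxx)).
      - apply Rmult_le_compat_l; nra.
      - apply Rmult_le_compat_r; nra. }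
    assert (A2 : (drift m d V - drift m d v) * Wx ^ 2 <= - (h * q / (4 * d)) * Wx ^ 2).
    { apply Rmult_le_compat_r; [apply pow2_ge_0|]. rewrite <- Hq. exact Hb. }
    replace (h * (m * d * Zxx + m * q * wxx - q / (4 * d) * Wx ^ 2 + drift m d v * (Wx + wx) * Zx))
      with (m * d * (h * Zxx) + m * (h * q) * wxx + - (h * q / (4 * d)) * Wx ^ 2
        + drift m d v * (Wx + wx) * (h * Zx)) by (field; lra).
    lra. }
  apply Rmult_le_reg_l in S1; [|exact Hh].
  (* At the touching point [wxx] is close to the slope [Zx] of the barrier, so this term is a
     transport term. Its [m], added to the [2 * (1 + m)] of [S4], makes the constant [2 + 3 * m]. *)
  assert (S2 : m * q * wxx <= m * z * (Rabs Zx + e)).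
  { assert (wxx <= Rabs Zx + e).
    { apply Rabs_le_between in He1. pose proof (Rle_abs Zx). lra. }
    pose proof (Rabs_pos Zx).
    apply Rle_trans with (m * q * (Rabs Zx + e)).
    - apply Rmult_le_compat_l; nra.
    - apply Rmult_le_compat_r; nra. }
  (* The damping loses a factor 2 through [q >= z / 2], which turns [4 * d] into [8 * d]. *)
  assert (S3 : z ^ 3 / (8 * d) - e * (z ^ 2 / (4 * d)) <= q / (4 * d) * Wx ^ 2).
  { pose proof (Rsqr_lower_bound Wx z e Hz He2) as A.
    replace (z ^ 3 / (8 * d) - e * (z ^ 2 / (4 * d))) with (z / 2 / (4 * d) * (z * z - 2 * z * e))
      by (field; lra).
    assert (0 < / (4 * d)) by (apply Rinv_0_lt_compat; lra).
    apply Rle_trans with (z / 2 / (4 * d) * Wx ^ 2).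
    - apply Rmult_le_compat_l; [apply Rdiv_le_0_compat; lra|]. nra.
    - apply Rmult_le_compat_r; [nra|]. unfold Rdiv. apply Rmult_le_compat_r; lra. }
  assert (S4 : drift m d v * (Wx + wx) * Zx <= (1 + m) * (2 * z + 2 * e) * Rabs Zx).
  { eapply Rle_trans; [apply Rle_abs|]. rewrite !Rabs_mult.
    apply Rmult_le_compat_r; [apply Rabs_pos|].
    apply Rmult_le_compat; [apply Rabs_pos|apply Rabs_pos|exact Hb1|].
    apply Rabs_le_between in He2. apply Rabs_le_between in He3. apply Rabs_le. lra. }
  nra.
Qed.

(* [P, Q, B] are the values of [1/(1-x), 1/(1+x), 1/(1+t)] at the touching point. *)
Lemma barrier_contradiction (m d l L e z P Q B : R) :
  0 < m -> 0 < d -> 0 < l -> 0 <= e ->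
  16 * d * (1 + 2 * m * d + (2 + 3 * m) * l) <= l ^ 2 ->
  / 2 <= P -> / 2 <= Q -> 1 <= B -> l * (P + Q + B) <= z -> z <= L ->
  e * (m * L + L ^ 2 / (4 * d) + 2 * (1 + m) * (L ^ 2 / l)) < l ^ 3 / (2 * d) ->
  - l * B ^ 2 + z ^ 3 / (8 * d) <=
    m * d * (2 * l * (P ^ 3 + Q ^ 3)) + (2 + 3 * m) * z * Rabs (l * (P ^ 2 - Q ^ 2))
    + e * (m * z + z ^ 2 / (4 * d) + 2 * (1 + m) * Rabs (l * (P ^ 2 - Q ^ 2))) -> False.
Proof.
  intros Hm Hd Hl He Hdl HP HQ HB Hz HL Herr H.
  assert (Hz2 : 2 * l <= z) by nra.
  set (X := Rabs (l * (P ^ 2 - Q ^ 2))) in *.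
  set (y := z / l).
  assert (Ey : z = l * y) by (unfold y; field; lra).
  assert (Hy : P + Q + B <= y).
  { apply (Rmult_le_reg_l l); [lra|]. rewrite <- Ey. lra. }
  assert (HX : X <= l * y ^ 2).
  { unfold X. rewrite Rabs_mult, (Rabs_pos_eq l) by lra.
    apply Rmult_le_compat_l; [lra|]. apply Rabs_le.
    split; nra. }
  assert (HX0 : 0 <= X) by apply Rabs_pos.
  assert (Hy2 : 0 <= B * B <= y ^ 2) by nra.
  assert (HB3 : B ^ 2 <= y ^ 3).
  { replace (y ^ 3) with (y * y ^ 2) by ring. nra. }
  assert (HPQ : P ^ 3 + Q ^ 3 <= y ^ 3).
  { apply Rle_trans with ((P + Q) ^ 3).
    - assert (0 <= P * Q * (P + Q)) by (repeat apply Rmult_le_pos; lra). nra.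
    - apply pow_incr. lra. }
  assert (Hy0 : 2 <= y) by lra.
  assert (HXL : X <= L ^ 2 / l).
  { apply Rle_trans with (l * y ^ 2); [exact HX|].
    replace (l * y ^ 2) with (z ^ 2 / l) by (rewrite Ey; field; lra).
    unfold Rdiv. apply Rmult_le_compat_r; [left; apply Rinv_0_lt_compat; lra|].
    apply pow_incr. lra. }
  assert (HE : e * (m * z + z ^ 2 / (4 * d) + 2 * (1 + m) * X)
     <= e * (m * L + L ^ 2 / (4 * d) + 2 * (1 + m) * (L ^ 2 / l))).
  { apply Rmult_le_compat_l; [exact He|].
    apply Rplus_le_compat; [apply Rplus_le_compat|].
    - apply Rmult_le_compat_l; lra.
    - unfold Rdiv. apply Rmult_le_compat_r; [left; apply Rinv_0_lt_compat; lra|].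
      apply pow_incr. lra.
    - apply Rmult_le_compat_l; lra. }
  assert (Hmain : l * B ^ 2 + m * d * (2 * l * (P ^ 3 + Q ^ 3)) + (2 + 3 * m) * z * X
     <= (l * y ^ 3) * (1 + 2 * m * d + (2 + 3 * m) * l)).
  { assert (A1 : l * B ^ 2 <= l * y ^ 3) by (apply Rmult_le_compat_l; lra).
    assert (A2 : m * d * (2 * l * (P ^ 3 + Q ^ 3)) <= m * d * (2 * l * y ^ 3)).
    { apply Rmult_le_compat_l; [nra|]. apply Rmult_le_compat_l; lra. }
    assert (A3 : (2 + 3 * m) * z * X <= (2 + 3 * m) * z * (l * y ^ 2)).
    { apply Rmult_le_compat_l; nra. }
    rewrite Ey in A3 |- *. nra. }
  (* Half of the damping absorbs every barrier term; this is exactly the smallness condition on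
     [d]. *)
  assert (Hmain2 : (l * y ^ 3) * (1 + 2 * m * d + (2 + 3 * m) * l) <= z ^ 3 / (16 * d)).
  { replace (z ^ 3 / (16 * d)) with ((l * y ^ 3) * (l ^ 2 / (16 * d))) by (rewrite Ey; field; lra).
    apply Rmult_le_compat_l.
    - apply Rmult_le_pos; [lra|]. apply pow_le; lra.
    - apply Rle_div_r; [lra|]. lra. }
  (* The other half is bounded below because [z >= 2 * l], and absorbs the discretisation error. *)
  assert (Hz3 : l ^ 3 / (2 * d) <= z ^ 3 / (16 * d)).
  { replace (l ^ 3 / (2 * d)) with ((2 * l) ^ 3 / (16 * d)) by (field; lra).
    unfold Rdiv. apply Rmult_le_compat_r; [left; apply Rinv_0_lt_compat; lra|].
    apply pow_incr. lra. }
  assert (Hz8 : z ^ 3 / (8 * d) = z ^ 3 / (16 * d) + z ^ 3 / (16 * d)) by (field; lra).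
  lra.
Qed.

(** * Maximum principle tools *)

Lemma is_derive_interior_max (f : R -> R) (x l eps : R) : 0 < eps -> is_derive f x l ->
  (forall y, Rabs (y - x) < eps -> f y <= f x) -> l = 0.
Proof.
  intros Heps Hf Hmax. apply is_derive_Reals in Hf.
  assert (pr : derivable_pt f x) by (exists l; exact Hf).
  rewrite <- (derive_pt_eq_0 f x l pr Hf).
  apply (deriv_maximum f (x - eps) (x + eps)); try lra.
  intros y Hy1 Hy2. apply Hmax. apply Rabs_def1; lra.
Qed.

(** One-sided, because the maximum over a space-time box may lie at its final time, where only
    earlier times are available for comparison. *)
Lemma is_derive_left_max (f : R -> R) (x l eps : R) : 0 < eps -> is_derive f x l ->
  (forall y, x - eps < y <= x -> f y <= f x) -> 0 <= l.
Proof.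
  intros Heps Hf Hmax. apply is_derive_Reals in Hf.
  destruct (Rle_lt_dec 0 l) as [|Hl]; [assumption|exfalso].
  destruct (Hf (- l)) as [del Hdel]; [lra|].
  set (k := Rmin del eps / 2).
  assert (Hk : 0 < k < Rmin del eps).
  { unfold k. pose proof (Rmin_pos del eps (cond_pos del) Heps). lra. }
  pose proof (Rmin_l del eps). pose proof (Rmin_r del eps).
  specialize (Hdel (- k)). assert (Hk0 : - k <> 0) by lra.
  assert (Hk1 : Rabs (- k) < del) by (rewrite Rabs_Ropp, Rabs_pos_eq; lra).
  specialize (Hdel Hk0 Hk1). apply Rabs_def2 in Hdel.
  specialize (Hmax (x + - k)).
  assert (Hle : f (x + - k) <= f x) by (apply Hmax; lra).
  assert (0 <= (f (x + - k) - f x) / - k).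
  { replace ((f (x + - k) - f x) / - k) with ((f x - f (x + - k)) / k) by (field; lra).
    apply Rdiv_le_0_compat; lra. }
  lra.
Qed.

Lemma second_derivative_max (f df : R -> R) (x l eps : R) : 0 < eps ->
  (forall y, Rabs (y - x) < eps -> is_derive f y (df y)) -> is_derive df x l ->
  (forall y, Rabs (y - x) < eps -> f y <= f x) -> l <= 0.
Proof.
  intros Heps Hf Hdf Hmax.
  assert (H0 : df x = 0).
  { apply (is_derive_interior_max f x _ eps Heps); [|exact Hmax].
    apply Hf. rewrite Rminus_diag, Rabs_R0. exact Heps. }
  apply is_derive_Reals in Hdf.
  destruct (Rle_lt_dec l 0) as [|Hl]; [assumption|exfalso].
  destruct (Hdf l Hl) as [del Hdel].
  set (k := Rmin del eps / 2).
  assert (Hk : 0 < k < Rmin del eps).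
  { unfold k. pose proof (Rmin_pos del eps (cond_pos del) Heps). lra. }
  pose proof (Rmin_l del eps). pose proof (Rmin_r del eps).
  destruct (MVT_cor2 f df x (x + k)) as [c [Ec Hc]]; [lra| |].
  - intros y Hy. apply is_derive_Reals. apply Hf. apply Rabs_def1; lra.
  - assert (Hfk : f (x + k) <= f x) by (apply Hmax; apply Rabs_def1; lra).
    assert (Hcx : c - x <> 0) by lra.
    specialize (Hdel (c - x) Hcx). rewrite Rplus_minus, H0 in Hdel.
    assert (Hcd : Rabs (c - x) < del) by (apply Rabs_def1; lra).
    specialize (Hdel Hcd). apply Rabs_def2 in Hdel.
    assert (Hq : 0 < (df c - 0) / (c - x)) by lra.
    assert (Hdc : 0 < df c).
    { replace (df c) with ((df c - 0) / (c - x) * (c - x)) by (field; lra).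
      apply Rmult_lt_0_compat; lra. }
    assert (0 < df c * (x + k - x)) by (apply Rmult_lt_0_compat; lra).
    lra.
Qed.

(** * Compactness and continuity in two variables *)

(** Projection onto [[a, b]]. Composing with it extends a function continuously beyond the interval,
    as needed for [continuity_ab_maj], which asks for two-sided continuity at the endpoints. *)
Definition clamp (a b x : R) : R := Rmax a (Rmin b x).

Lemma clamp_in (a b x : R) : a <= b -> a <= clamp a b x <= b.
Proof.
  intros H. unfold clamp. split; [apply Rmax_l|].
  apply Rmax_lub; [exact H|apply Rmin_l].
Qed.

Lemma clamp_id (a b x : R) : a <= x <= b -> clamp a b x = x.
Proof.
  intros H. unfold clamp. rewrite Rmin_right by lra. apply Rmax_right; lra.
Qed.

Lemma clamp_lipschitz (a b x y : R) : Rabs (clamp a b x - clamp a b y) <= Rabs (x - y).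
Proof.
  unfold clamp, Rmax, Rmin, Rabs.
  repeat destruct Rle_dec; repeat destruct Rcase_abs; lra.
Qed.

Lemma continuous2_uniform (f : R -> R -> R) (a b c d : R) :
  (forall x y, a <= x <= b -> c <= y <= d -> continuous2 f x y) ->
  forall eps, 0 < eps -> exists delta, 0 < delta /\
    forall x y x' y', a <= x <= b -> c <= y <= d -> a <= x' <= b -> c <= y' <= d ->
      Rabs (x' - x) < delta -> Rabs (y' - y) < delta -> Rabs (f x' y' - f x y) < eps.
Proof.
  intros Hf eps Heps.
  destruct (uniform_continuity_2d f a b c d) with (eps := mkposreal eps Heps) as [delta H].
  - intros x y Hx Hy. apply continuity_2d_pt_filterlim. apply Hf; assumption.
  - exists delta. split; [apply cond_pos|]. intros. apply H; assumption.
Qed.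

(** Iterated maximisation: first in [y] for each [x], then in [x]. The maximiser [g] obtained by
    choice need not be continuous, but the maximal value is, by uniform continuity of [f]. *)
Lemma continuous2_max (f : R -> R -> R) (a b c d : R) : a <= b -> c <= d ->
  (forall x y, a <= x <= b -> c <= y <= d -> continuous2 f x y) ->
  exists x0 y0, a <= x0 <= b /\ c <= y0 <= d /\
    forall x y, a <= x <= b -> c <= y <= d -> f x y <= f x0 y0.
Proof.
  intros Hab Hcd Hf.
  pose proof (continuous2_uniform f a b c d Hf) as Huc.
  assert (Hin : forall x, exists y, c <= y <= d /\
     forall y', c <= y' <= d -> f (clamp a b x) y' <= f (clamp a b x) y).
  { intros x.
    destruct (continuity_ab_maj (fun y => f (clamp a b x) (clamp c d y)) c d Hcd) as [y [Hy1 Hy2]].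
    - intros y Hy eps Heps. destruct (Huc eps Heps) as [del [Hdel Hu]].
      exists del. split; [exact Hdel|]. intros y' [_ Hy']. simpl in *. unfold R_dist in *.
      pose proof (clamp_in a b x Hab).
      apply Hu; try assumption; try (apply clamp_in; assumption).
      + rewrite Rminus_diag, Rabs_R0. exact Hdel.
      + eapply Rle_lt_trans; [apply clamp_lipschitz|exact Hy'].
    - exists y. split; [exact Hy2|]. intros y' Hy'. specialize (Hy1 y' Hy').
      rewrite (clamp_id c d y), (clamp_id c d y') in Hy1 by assumption. exact Hy1. }
  apply functional_choice in Hin. destruct Hin as [g Hg].
  destruct (continuity_ab_maj (fun x => f (clamp a b x) (g x)) a b Hab) as [x0 [Hx1 Hx2]].
  - intros x Hx eps Heps. destruct (Huc eps Heps) as [del [Hdel Hu]].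
    exists del. split; [exact Hdel|]. intros x' [_ Hx']. simpl in *. unfold R_dist in *.
    destruct (Hg x) as [G1 G2]. destruct (Hg x') as [G1' G2'].
    assert (Hc : forall y, c <= y <= d ->
       Rabs (f (clamp a b x') y - f (clamp a b x) y) < eps).
    { intros y Hy. apply Hu; try assumption; try (apply clamp_in; assumption).
      - eapply Rle_lt_trans; [apply clamp_lipschitz|exact Hx'].
      - rewrite Rminus_diag, Rabs_R0. exact Hdel. }
    (* Each maximal value is compared with the other slice at the same maximiser, so the two values
       differ by less than [eps] however far apart [g x] and [g x'] are. *)
    pose proof (Hc _ G1) as C1. pose proof (Hc _ G1') as C2.
    apply Rabs_def2 in C1. apply Rabs_def2 in C2.
    specialize (G2 _ G1'). specialize (G2' _ G1).
    apply Rabs_def1; lra.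
  - exists x0, (g x0). destruct (Hg x0) as [G1 G2].
    split; [exact Hx2|]. split; [exact G1|].
    intros x y Hx Hy. specialize (Hx1 x Hx). rewrite (clamp_id a b x0) in Hx1 by assumption.
    rewrite (clamp_id a b x) in Hx1 by assumption.
    destruct (Hg x) as [_ G4]. rewrite (clamp_id a b x) in G4 by assumption.
    eapply Rle_trans; [apply G4; exact Hy|exact Hx1].
Qed.

Lemma continuous2_const (c x t : R) : continuous2 (fun _ _ => c) x t.
Proof. apply continuous_const. Qed.

Lemma continuous2_plus (f g : R -> R -> R) (x t : R) :
  continuous2 f x t -> continuous2 g x t -> continuous2 (fun y s => f y s + g y s) x t.
Proof. intros Hf Hg. exact (continuous_plus _ _ _ Hf Hg). Qed.

Lemma continuous2_minus (f g : R -> R -> R) (x t : R) :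
  continuous2 f x t -> continuous2 g x t -> continuous2 (fun y s => f y s - g y s) x t.
Proof. intros Hf Hg. exact (continuous_minus _ _ _ Hf Hg). Qed.

Lemma continuous2_mult (f g : R -> R -> R) (x t : R) :
  continuous2 f x t -> continuous2 g x t -> continuous2 (fun y s => f y s * g y s) x t.
Proof. intros Hf Hg. exact (continuous_mult _ _ _ Hf Hg). Qed.

Lemma continuous2_comp (k : R -> R) (f : R -> R -> R) (x t : R) :
  continuous2 f x t -> continuous k (f x t) -> continuous2 (fun y s => k (f y s)) x t.
Proof. intros Hf Hk. exact (continuous_comp (fun z => f (fst z) (snd z)) k (x, t) Hf Hk). Qed.

Lemma continuous2_pair (f p q : R -> R -> R) (x t : R) :
  continuous2 p x t -> continuous2 q x t -> continuous2 f (p x t) (q x t) ->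
  continuous2 (fun y s => f (p y s) (q y s)) x t.
Proof.
  intros Hp Hq Hf.
  exact (continuous_comp_2 (fun z => p (fst z) (snd z)) (fun z => q (fst z) (snd z)) f (x, t) Hp Hq Hf).
Qed.

Lemma continuous2_fst (x t : R) : continuous2 (fun y _ => y) x t.
Proof. apply continuous_fst. Qed.

Lemma continuous2_snd (x t : R) : continuous2 (fun _ s => s) x t.
Proof. apply continuous_snd. Qed.

Lemma continuous2_affine (f : R -> R -> R) (a b c d x t : R) :
  continuous2 f (a + b * x) (c + d * t) ->
  continuous2 (fun y s => f (a + b * y) (c + d * s)) x t.
Proof.
  intros Hf. apply (continuous2_pair f (fun y _ => a + b * y) (fun _ s => c + d * s)).
  - apply continuous2_plus; [apply continuous2_const|].
    apply continuous2_mult; [apply continuous2_const|apply continuous2_fst].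
  - apply continuous2_plus; [apply continuous2_const|].
    apply continuous2_mult; [apply continuous2_const|apply continuous2_snd].
  - exact Hf.
Qed.

Lemma continuous2_bounded (f : R -> R -> R) (a b c d : R) : a <= b -> c <= d ->
  (forall x y, a <= x <= b -> c <= y <= d -> continuous2 f x y) ->
  exists L, 0 <= L /\ forall x y, a <= x <= b -> c <= y <= d -> Rabs (f x y) <= L.
Proof.
  intros Hab Hcd Hf.
  destruct (continuous2_max (fun x y => Rabs (f x y)) a b c d Hab Hcd) as (x0 & y0 & _ & _ & H).
  - intros x y Hx Hy. apply (continuous2_comp Rabs f); [apply Hf; assumption|].
    apply continuous_Rabs.
  - exists (Rabs (f x0 y0)). split; [apply Rabs_pos|exact H].
Qed.

(** * The local gradient estimate *)

(* [m] plays the role of [p - 1]. *)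
Record pressure_solution (m : R) (v vt vx vxx : R -> R -> R) : Prop := {
  ps_t : forall x t, t <= 0 -> is_derive (fun s => v x s) t (vt x t);
  ps_x : forall x t, t <= 0 -> is_derive (fun y => v y t) x (vx x t);
  ps_xx : forall x t, t <= 0 -> is_derive (fun y => vx y t) x (vxx x t);
  ps_cont : forall x t, t <= 0 -> continuous2 v x t;
  ps_cont_x : forall x t, t <= 0 -> continuous2 vx x t;
  ps_cont_xx : forall x t, t <= 0 -> continuous2 vxx x t;
  ps_pos : forall x t, t <= 0 -> 0 < v x t;
  ps_eq : forall x t, t <= 0 -> vt x t = m * v x t * vxx x t + vx x t ^ 2 }.

(** It blows up at [x = -1], [x = 1] and [t = -1], the parabolic boundary of the box, stays finite
    at the final time [t = 0], and equals [3 * l] at the origin. *)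
Definition barrier (l x t : R) : R := l * (/ (1 - x) + / (1 + x) + / (1 + t)).

Lemma barrier_dx (l x t : R) : -1 < x < 1 ->
  is_derive (fun y => barrier l y t) x (l * ((/ (1 - x)) ^ 2 - (/ (1 + x)) ^ 2)).
Proof. intros Hx. unfold barrier. auto_derive; [lra|field; lra]. Qed.

Lemma barrier_dxx (l x : R) : -1 < x < 1 ->
  is_derive (fun y => l * ((/ (1 - y)) ^ 2 - (/ (1 + y)) ^ 2)) x
    (2 * l * ((/ (1 - x)) ^ 3 + (/ (1 + x)) ^ 3)).
Proof. intros Hx. auto_derive; [lra|field; lra]. Qed.

Lemma barrier_dt (l x t : R) : -1 < t ->
  is_derive (fun s => barrier l x s) t (- l * (/ (1 + t)) ^ 2).
Proof. intros Ht. unfold barrier. auto_derive; [lra|field; lra]. Qed.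

Lemma continuous2_barrier (l x t : R) : -1 < x < 1 -> -1 < t -> continuous2 (barrier l) x t.
Proof.
  intros Hx Ht. unfold barrier.
  apply continuous2_mult; [apply continuous2_const|].
  apply continuous2_plus; [apply continuous2_plus|].
  - apply (continuous2_comp Rinv (fun y _ => 1 - y)); [|apply continuous_Rinv; lra].
    apply continuous2_minus; [apply continuous2_const|apply continuous2_fst].
  - apply (continuous2_comp Rinv (fun y _ => 1 + y)); [|apply continuous_Rinv; lra].
    apply continuous2_plus; [apply continuous2_const|apply continuous2_fst].
  - apply (continuous2_comp Rinv (fun _ s => 1 + s)); [|apply continuous_Rinv; lra].
    apply continuous2_plus; [apply continuous2_const|apply continuous2_snd].
Qed.

(* Since only C^{2,1} regularity is available, the Bernstein argument is run on the difference quotient [z] of [w] rather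
   than on [w_x]; the step [h] is chosen so small that the errors, controlled
   by uniform continuity of [w_xx], do not spoil the strict inequality. *)
Lemma unit_gradient_bound (m d l : R) (v vt vx vxx : R -> R -> R) :
  0 < m -> 0 < d -> 0 < l -> 16 * d * (1 + 2 * m * d + (2 + 3 * m) * l) <= l ^ 2 ->
  pressure_solution m v vt vx vxx ->
  (forall x t, -2 <= x <= 2 -> -1 <= t <= 0 -> v x t <= d) ->
  vx 0 0 <= 3 * l.
Proof.
  intros Hm Hd Hl Hdl [Dt Dx Dxx Cv Cx Cxx Pos Eq] Hvd.
  destruct (Rle_lt_dec (vx 0 0) (3 * l)) as [|Hcontra]; [assumption|exfalso].
  set (w := fun x t => v x t + v x t ^ 2 / (2 * d)).
  set (wt := fun x t => (1 + v x t / d) * vt x t).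
  set (wx := fun x t => (1 + v x t / d) * vx x t).
  set (wxx := fun x t => (1 + v x t / d) * vxx x t + vx x t ^ 2 / d).
  assert (Wt : forall x t, t <= 0 -> is_derive (fun s => w x s) t (wt x t)).
  { intros x t Ht. unfold w, wt. specialize (Dt x t Ht).
    auto_derive; [repeat split; eexists; eassumption|].
    rewrite (is_derive_unique (fun s : R => v x s) _ _ Dt). field; lra. }
  assert (Wx : forall x t, t <= 0 -> is_derive (fun y => w y t) x (wx x t)).
  { intros x t Ht. unfold w, wx. specialize (Dx x t Ht).
    auto_derive; [repeat split; eexists; eassumption|].
    rewrite (is_derive_unique (fun s : R => v s t) _ _ Dx). field; lra. }
  assert (Wxx : forall x t, t <= 0 -> is_derive (fun y => wx y t) x (wxx x t)).
  { intros x t Ht. unfold wx, wxx. specialize (Dx x t Ht). specialize (Dxx x t Ht).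
    auto_derive; [repeat split; eexists; eassumption|].
    rewrite (is_derive_unique (fun s : R => v s t) _ _ Dx), (is_derive_unique (fun s : R => vx s t) _ _ Dxx). field; lra. }
  assert (Cw : forall x t, t <= 0 -> continuous2 w x t).
  { intros x t Ht. unfold w.
    apply continuous2_plus; [apply Cv; assumption|].
    apply (continuous2_mult (fun y s => v y s ^ 2)); [|apply continuous2_const].
    apply continuous2_mult; [apply Cv; assumption|].
    apply continuous2_mult; [apply Cv; assumption|apply continuous2_const]. }
  assert (C1 : forall x t, t <= 0 -> continuous2 (fun y s => 1 + v y s / d) x t).
  { intros x t Ht. apply continuous2_plus; [apply continuous2_const|].
    apply (continuous2_mult v); [apply Cv; assumption|apply continuous2_const]. }
  assert (Cwx : forall x t, t <= 0 -> continuous2 wx x t).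
  { intros x t Ht. unfold wx. apply continuous2_mult; [apply C1|apply Cx]; assumption. }
  assert (Cwxx : forall x t, t <= 0 -> continuous2 wxx x t).
  { intros x t Ht. unfold wxx. apply continuous2_plus.
    - apply continuous2_mult; [apply C1|apply Cxx]; assumption.
    - apply (continuous2_mult (fun y s => vx y s ^ 2)); [|apply continuous2_const].
      apply continuous2_mult; [apply Cx; assumption|].
      apply continuous2_mult; [apply Cx; assumption|apply continuous2_const]. }
  assert (Weq : forall x t, t <= 0 -> wt x t = m * v x t * wxx x t + drift m d (v x t) * wx x t ^ 2).
  { intros x t Ht. unfold wt, wx, wxx, drift. rewrite Eq by assumption.
    pose proof (Pos x t Ht). field. lra. }
  destruct (continuous2_bounded wx (-2) 2 (-1) 0) as [L1 [HL1 BL1]]; try lra.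
  { intros; apply Cwx; lra. }
  destruct (continuous2_bounded wxx (-2) 2 (-1) 0) as [L2 [HL2 BL2]]; try lra.
  { intros; apply Cwxx; lra. }
  (* [L1] will bound the quotient [z]; adding [l] makes [L] positive even when [L1 = 0]. [K] is the
     error bracket of [barrier_contradiction], and [e] is chosen to make [e * K] smaller than the
     damping left over there. *)
  set (L := L1 + l).
  set (K := m * L + L ^ 2 / (4 * d) + 2 * (1 + m) * (L ^ 2 / l)).
  assert (HK : 0 <= K).
  { unfold K. assert (0 <= L ^ 2 / (4 * d)) by (apply Rdiv_le_0_compat; [apply pow2_ge_0|lra]).
    assert (0 <= L ^ 2 / l) by (apply Rdiv_le_0_compat; [apply pow2_ge_0|lra]).
    unfold L in *. nra. }
  assert (Hl3 : 0 < l ^ 3 / (2 * d)) by (apply Rdiv_lt_0_compat; [apply pow_lt|]; lra).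
  set (e := l ^ 3 / (2 * d) / (2 * (K + 1))).
  assert (He : 0 < e) by (unfold e; apply Rdiv_lt_0_compat; lra).
  assert (HeK : e * K < l ^ 3 / (2 * d)).
  { assert (E : e * (2 * (K + 1)) = l ^ 3 / (2 * d)) by (unfold e; field; lra). nra. }
  destruct (continuous2_uniform wxx (-2) 2 (-1) 0) with (eps := e) as [del [Hdel Hu]].
  { intros; apply Cwxx; lra. }
  { exact He. }
  assert (Hwx00 : 3 * l < wx 0 0).
  { unfold wx. pose proof (Pos 0 0 (Rle_refl 0)).
    assert (0 < v 0 0 / d) by (apply Rdiv_lt_0_compat; lra). nra. }
  (* The four demands on [h]: [x + h] stays in [[-2, 2]]; [wxx] varies by less than [e] over a step;
     [wx] varies by at most [e]; and at the origin [z] still exceeds the barrier value [3 * l]. *)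
  assert (Hh : exists h, 0 < h < 1 /\ h < del /\ L2 * h <= e /\ L2 * h < wx 0 0 - 3 * l).
  { set (h := Rmin (Rmin (/ 2) (del / 2)) (Rmin e (wx 0 0 - 3 * l) / (L2 + 1))).
    assert (Hmin : 0 < Rmin e (wx 0 0 - 3 * l)) by (apply Rmin_pos; lra).
    assert (Hh : 0 < h).
    { unfold h. apply Rmin_pos; [apply Rmin_pos; lra|]. apply Rdiv_lt_0_compat; lra. }
    assert (h1 : h <= Rmin (/ 2) (del / 2)) by apply Rmin_l.
    assert (h2 : h <= Rmin e (wx 0 0 - 3 * l) / (L2 + 1)) by apply Rmin_r.
    pose proof (Rmin_l (/ 2) (del / 2)). pose proof (Rmin_r (/ 2) (del / 2)).
    pose proof (Rmin_l e (wx 0 0 - 3 * l)). pose proof (Rmin_r e (wx 0 0 - 3 * l)).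
    apply Rle_div_r in h2; [|lra].
    exists h. repeat split; nra. }
  destruct Hh as (h & Hh & Hhdel & Hhe & Hh0).
  assert (MVx : forall x t, -1 <= x <= 1 -> -1 <= t <= 0 ->
     exists c, x < c < x + h /\ w (x + h) t - w x t = h * wx c t).
  { intros x t Hx Ht. destruct (MVT_cor2 (fun y => w y t) (fun y => wx y t) x (x + h)) as [c [Ec Hc]].
    - lra.
    - intros c Hc. apply is_derive_Reals, Wx. lra.
    - exists c. split; [exact Hc|]. rewrite Ec. ring. }
  assert (MVxx : forall x y t, -2 <= x <= 2 -> -2 <= y <= 2 -> -1 <= t <= 0 -> Rabs (y - x) <= h ->
     Rabs (wx y t - wx x t) <= L2 * h).
  { intros x y t Hx Hy Ht Hxy. destruct (MVT_gen (fun y => wx y t) x y (fun y => wxx y t)) as [c [Hc Ec]].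
    - intros; apply Wxx; lra.
    - intros z Hz. apply continuity_pt_filterlim, (ex_derive_continuous (fun y => wx y t)).
      exists (wxx z t). apply Wxx; lra.
    - rewrite Ec, Rabs_mult. apply Rmult_le_compat; try apply Rabs_pos; [|exact Hxy].
      apply BL2; [|exact Ht].
      pose proof (Rmin_glb x y (-2)). pose proof (Rmax_lub x y 2). lra. }
  set (z := fun x t => (w (x + h) t - w x t) / h).
  assert (Hzw : forall x t, w (x + h) t - w x t = h * z x t) by (intros; unfold z; field; lra).
  assert (HzL : forall x t, -1 <= x <= 1 -> -1 <= t <= 0 -> Rabs (z x t) <= L1).
  { intros x t Hx Ht. destruct (MVx x t Hx Ht) as [c [Hc Ec]].
    assert (z x t = wx c t) as -> by (unfold z; rewrite Ec; field; lra).
    apply BL1; lra. }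
  (* The box is shrunk by [eta] to avoid the singularities of the barrier. Since [l / eta = 2 * L],
     the barrier exceeds any value of [z] on the new parabolic boundary, which keeps the touching
     point off it. *)
  set (eta := l / L / 2).
  assert (Heta : 0 < eta < 1 /\ l / eta > L).
  { unfold eta, L. split; [split|].
    - apply Rdiv_lt_0_compat; [apply Rdiv_lt_0_compat|]; lra.
    - assert (l / (L1 + l) <= 1) by (apply Rle_div_l; lra). lra.
    - replace (l / (l / (L1 + l) / 2)) with (2 * (L1 + l)) by (field; lra). lra. }
  destruct Heta as [Heta HetaL].
  destruct (continuous2_max (fun x t => z x t - barrier l x t) (-1 + eta) (1 - eta) (-1 + eta) 0)
    as (x0 & t0 & Hx0 & Ht0 & Hmax); try lra.
  { intros x t Hx Ht. apply continuous2_minus.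
    - apply (continuous2_mult (fun x t => w (x + h) t - w x t)); [|apply continuous2_const].
      apply continuous2_minus; [|apply Cw; lra].
      apply (continuous2_pair w (fun y _ => y + h) (fun _ s => s)).
      + apply continuous2_plus; [apply continuous2_fst|apply continuous2_const].
      + apply continuous2_snd.
      + apply Cw; lra.
    - apply continuous2_barrier; lra. }
  assert (Hpos : barrier l x0 t0 < z x0 t0).
  { specialize (Hmax 0 0). assert (Hb0 : barrier l 0 0 = 3 * l) by (unfold barrier; field; lra).
    destruct (MVx 0 0) as [c [Hc Ec]]; try lra.
    assert (Ez : z 0 0 = wx c 0) by (unfold z; rewrite Ec; field; lra).
    assert (Rabs (wx c 0 - wx 0 0) <= L2 * h) by (apply MVxx; try lra; apply Rabs_le; lra).
    assert (Hc0 := H). apply Rabs_le_between in Hc0.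
    rewrite Hb0, Ez in Hmax. assert (wx c 0 - 3 * l <= z x0 t0 - barrier l x0 t0) by (apply Hmax; lra).
    lra. }
  assert (HzL0 : z x0 t0 <= L1).
  { eapply Rle_trans; [apply Rle_abs|]. apply HzL; lra. }
  set (P := / (1 - x0)). set (Q := / (1 + x0)). set (B := / (1 + t0)).
  assert (Hbar : barrier l x0 t0 = l * (P + Q + B)) by reflexivity.
  assert (HP : / 2 <= P) by (apply Rinv_le_contravar; lra).
  assert (HQ : / 2 <= Q) by (apply Rinv_le_contravar; lra).
  assert (HB : 1 <= B) by (rewrite <- Rinv_1; apply Rinv_le_contravar; lra).
  assert (Hint : -1 + eta < x0 < 1 - eta /\ -1 + eta < t0).
  { assert (Hle : l * / eta > L) by exact HetaL.
    assert (Hx1 : x0 <> 1 - eta).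
    { intros E. assert (P = / eta) by (unfold P; f_equal; lra). unfold L in *. nra. }
    assert (Hx2 : x0 <> -1 + eta).
    { intros E. assert (Q = / eta) by (unfold Q; f_equal; lra). unfold L in *. nra. }
    assert (Hx3 : t0 <> -1 + eta).
    { intros E. assert (B = / eta) by (unfold B; f_equal; lra). unfold L in *. nra. }
    lra. }
  destruct Hint as [Hix Hit].
  set (rad := Rmin (Rmin (x0 - (-1 + eta)) (1 - eta - x0)) (t0 - (-1 + eta))).
  assert (Hrad : 0 < rad) by (unfold rad; repeat apply Rmin_pos; lra).
  assert (Hrad1 : rad <= x0 - (-1 + eta) /\ rad <= 1 - eta - x0 /\ rad <= t0 - (-1 + eta)).
  { pose proof (Rmin_l (x0 - (-1 + eta)) (1 - eta - x0)).
    pose proof (Rmin_r (x0 - (-1 + eta)) (1 - eta - x0)).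
    pose proof (Rmin_l (Rmin (x0 - (-1 + eta)) (1 - eta - x0)) (t0 - (-1 + eta))).
    pose proof (Rmin_r (Rmin (x0 - (-1 + eta)) (1 - eta - x0)) (t0 - (-1 + eta))).
    unfold rad. lra. }
  destruct Hrad1 as (Hr1 & Hr2 & Hr3).
  assert (Dxz : forall x t, t <= 0 -> is_derive (fun y => z y t) x ((wx (x + h) t - wx x t) / h)).
  { intros x t Ht. unfold z.
    pose proof (Wx (x + h) t Ht) as D1. pose proof (Wx x t Ht) as D2.
    auto_derive; [repeat split; eexists; eassumption|].
    rewrite (is_derive_unique (fun s : R => w s t) _ _ D1), (is_derive_unique (fun s : R => w s t) _ _ D2). field; lra. }
  assert (Dxxz : forall x t, t <= 0 ->
     is_derive (fun y => (wx (y + h) t - wx y t) / h) x ((wxx (x + h) t - wxx x t) / h)).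
  { intros x t Ht.
    pose proof (Wxx (x + h) t Ht) as D1. pose proof (Wxx x t Ht) as D2.
    auto_derive; [repeat split; eexists; eassumption|].
    rewrite (is_derive_unique (fun s : R => wx s t) _ _ D1), (is_derive_unique (fun s : R => wx s t) _ _ D2). field; lra. }
  assert (Dtz : forall x t, t <= 0 -> is_derive (fun s => z x s) t ((wt (x + h) t - wt x t) / h)).
  { intros x t Ht. unfold z.
    pose proof (Wt (x + h) t Ht) as D1. pose proof (Wt x t Ht) as D2.
    auto_derive; [repeat split; eexists; eassumption|].
    rewrite (is_derive_unique (fun s : R => w (x + h) s) _ _ D1), (is_derive_unique (fun s : R => w x s) _ _ D2). field; lra. }
  assert (Hmaxx : forall y, Rabs (y - x0) < rad ->
     z y t0 - barrier l y t0 <= z x0 t0 - barrier l x0 t0).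
  { intros y Hy. apply Rabs_def2 in Hy. apply Hmax; lra. }
  set (ZX := fun x => l * ((/ (1 - x)) ^ 2 - (/ (1 + x)) ^ 2)).
  assert (E1 : (wx (x0 + h) t0 - wx x0 t0) / h - ZX x0 = 0).
  { apply (is_derive_interior_max (fun y => z y t0 - barrier l y t0) x0 _ rad Hrad); [|exact Hmaxx].
    apply (is_derive_minus (fun y => z y t0) (fun y => barrier l y t0)).
    - apply Dxz; lra.
    - apply barrier_dx; lra. }
  assert (E2 : (wxx (x0 + h) t0 - wxx x0 t0) / h - 2 * l * (P ^ 3 + Q ^ 3) <= 0).
  { apply (second_derivative_max (fun y => z y t0 - barrier l y t0)
      (fun y => (wx (y + h) t0 - wx y t0) / h - ZX y) x0 _ rad Hrad); [| |exact Hmaxx].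
    - intros y Hy. apply Rabs_def2 in Hy.
      apply (is_derive_minus (fun y => z y t0) (fun y => barrier l y t0)).
      + apply Dxz; lra.
      + apply barrier_dx; lra.
    - apply (is_derive_minus (fun y => (wx (y + h) t0 - wx y t0) / h) ZX).
      + apply Dxxz; lra.
      + apply barrier_dxx; lra. }
  assert (E3 : 0 <= (wt (x0 + h) t0 - wt x0 t0) / h - (- l * B ^ 2)).
  { apply (is_derive_left_max (fun s => z x0 s - barrier l x0 s) t0 _ rad Hrad).
    - apply (is_derive_minus (fun s => z x0 s) (fun s => barrier l x0 s)).
      + apply Dtz; lra.
      + apply barrier_dt; lra.
    - intros s Hs. apply Hmax; lra. }
  assert (Hscale : forall b, b = h * (b / h)) by (intros; field; lra).
  assert (F1 : wx (x0 + h) t0 - wx x0 t0 = h * ZX x0).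
  { rewrite (Hscale (_ - _)). apply (f_equal (Rmult h)). lra. }
  assert (F2 : wxx (x0 + h) t0 - wxx x0 t0 <= h * (2 * l * (P ^ 3 + Q ^ 3))).
  { rewrite (Hscale (_ - _)). apply Rmult_le_compat_l; lra. }
  assert (F3 : h * (- l * B ^ 2) <= wt (x0 + h) t0 - wt x0 t0).
  { rewrite (Hscale (_ - _)). apply Rmult_le_compat_l; lra. }
  destruct (MVx x0 t0) as [c [Hc Ec]]; try lra.
  assert (Ez : z x0 t0 = wx c t0) by (unfold z; rewrite Ec; field; lra).
  assert (F4 : Rabs (wxx x0 t0 - ZX x0) <= e).
  { destruct (MVT_cor2 (fun y => wx y t0) (fun y => wxx y t0) x0 (x0 + h)) as [c' [Ec' Hc']].
    - lra.
    - intros c' Hc'. apply is_derive_Reals, Wxx. lra.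
    (* The first-order condition [F1] makes the barrier slope the difference quotient of [wx], hence
       a value of [wxx] within distance [h]; uniform continuity does the rest. *)
    - assert (ZX x0 = wxx c' t0) as ->.
      { apply (Rmult_eq_reg_l h); [|lra]. rewrite <- F1, Ec'. ring. }
      left. apply Hu; try lra.
      + apply Rabs_def1; lra.
      + rewrite Rminus_diag, Rabs_R0. exact Hdel. }
  assert (F5 : Rabs (wx (x0 + h) t0 - z x0 t0) <= e).
  { rewrite Ez. eapply Rle_trans; [apply MVxx|exact Hhe]; try lra. apply Rabs_le; lra. }
  assert (F6 : Rabs (wx x0 t0 - z x0 t0) <= e).
  { rewrite Ez. eapply Rle_trans; [apply MVxx|exact Hhe]; try lra. apply Rabs_le; lra. }
  assert (Hz0 : 0 < z x0 t0) by (rewrite Hbar in Hpos; nra).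
  assert (HZxx : 0 <= 2 * l * (P ^ 3 + Q ^ 3)).
  { assert (0 <= P ^ 3) by (apply pow_le; lra). assert (0 <= Q ^ 3) by (apply pow_le; lra). nra. }
  apply (barrier_contradiction m d l L e (z x0 t0) P Q B); try assumption; try lra.
  { unfold L. lra. }
  apply (touching_inequality m d h e (v x0 t0) (v (x0 + h) t0) (wx x0 t0) (wx (x0 + h) t0)
    (wxx x0 t0) (wxx (x0 + h) t0) (wt x0 t0) (wt (x0 + h) t0)); try assumption; try lra.
  - split; [apply Pos|apply Hvd]; lra.
  - split; [apply Pos|apply Hvd]; lra.
  - apply Weq; lra.
  - apply Weq; lra.
  - apply Hzw.
Qed.

(** * The pressure of a solution *)

Lemma is_derive_Rpower_comp (f : R -> R) (a x l : R) : 0 < f x -> is_derive f x l ->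
  is_derive (fun y => Rpower (f y) a) x (a * Rpower (f x) (a - 1) * l).
Proof.
  intros Hf Hl.
  replace (a * Rpower (f x) (a - 1) * l) with (scal l (a * Rpower (f x) (a - 1)))
    by (unfold scal; simpl; unfold mult; simpl; ring).
  apply (is_derive_comp (fun r => Rpower r a) f x); [|exact Hl].
  apply is_derive_Reals, derivable_pt_lim_power, Hf.
Qed.

Lemma continuous2_Rpower (f : R -> R -> R) (a x t : R) : 0 < f x t ->
  continuous2 f x t -> continuous2 (fun y s => Rpower (f y s) a) x t.
Proof.
  intros Hf Hc. apply (continuous2_comp (fun r => Rpower r a) f); [exact Hc|].
  apply (ex_derive_continuous (fun r => Rpower r a)).
  exists (a * Rpower (f x t) (a - 1)). apply is_derive_Reals, derivable_pt_lim_power, Hf.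
Qed.

Lemma C21_ancient_derivatives (u : R -> R -> R) (x t : R) : C21_ancient u -> t < 0 ->
  is_derive (fun s => u x s) t (dt u x t) /\
  is_derive (fun y => u y t) x (dx u x t) /\
  is_derive (fun y => dx u y t) x (dxx u x t).
Proof.
  intros Hreg Ht. destruct (Hreg x t Ht) as (H1 & H2 & H3 & _).
  split; [|split]; apply Derive_correct; assumption.
Qed.

Lemma C21_ancient_continuity (u : R -> R -> R) (x t : R) : C21_ancient u -> t < 0 ->
  continuous2 u x t /\ continuous2 (dx u) x t /\ continuous2 (dxx u) x t.
Proof.
  intros Hreg Ht. destruct (Hreg x t Ht) as (_ & _ & _ & H1 & _ & H2 & H3). auto.
Qed.

Lemma Rpower_pred (r a : R) : 0 < r -> Rpower r a = Rpower r (a - 1) * r.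
Proof.
  intros Hr. rewrite <- (Rpower_1 r) at 3 by exact Hr.
  rewrite <- Rpower_plus. f_equal. ring.
Qed.

Definition pressure (p : R) (u : R -> R -> R) (x t : R) : R :=
  p / (p - 1) * Rpower (u x t) (p - 1).
Definition pressure_t (p : R) (u : R -> R -> R) (x t : R) : R :=
  p * Rpower (u x t) (p - 2) * dt u x t.
Definition pressure_x (p : R) (u : R -> R -> R) (x t : R) : R :=
  p * Rpower (u x t) (p - 2) * dx u x t.
Definition pressure_xx (p : R) (u : R -> R -> R) (x t : R) : R :=
  p * (p - 2) * Rpower (u x t) (p - 3) * dx u x t ^ 2 + p * Rpower (u x t) (p - 2) * dxx u x t.

(** Regularity is assumed for [u], whereas the equation differentiates [u ^ p]; positivity of [u]
    makes the chain rule legitimate for every real exponent. *)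
Lemma positive_ancient_solution_PME_expand (p : R) (u : R -> R -> R) :
  positive_ancient_solution_PME p u -> forall x t, t < 0 ->
  dt u x t = p * (p - 1) * Rpower (u x t) (p - 2) * dx u x t ^ 2
    + p * Rpower (u x t) (p - 1) * dxx u x t.
Proof.
  intros (Hreg & Hpos & Heq) x t Ht. rewrite Heq by exact Ht.
  assert (Dx : forall y, is_derive (fun y => u y t) y (dx u y t)).
  { intros y. exact (proj1 (proj2 (C21_ancient_derivatives u y t Hreg Ht))). }
  assert (Dxx : is_derive (fun y => dx u y t) x (dxx u x t)).
  { exact (proj2 (proj2 (C21_ancient_derivatives u x t Hreg Ht))). }
  unfold dxx at 1, dx at 1.
  rewrite (Derive_ext _ (fun y => p * Rpower (u y t) (p - 1) * dx u y t)).
  2: { intros y. apply is_derive_unique.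
       apply (is_derive_Rpower_comp (fun y => u y t)); [apply Hpos, Ht|apply Dx]. }
  apply is_derive_unique.
  pose proof (is_derive_Rpower_comp (fun y => u y t) (p - 1) x _ (Hpos x t Ht) (Dx x)) as D1.
  pose proof (is_derive_mult _ _ x _ _ (is_derive_scal _ x p _ D1) Dxx Rmult_comm) as D2.
  replace (_ + _) with (plus (mult (p * ((p - 1) * Rpower (u x t) (p - 1 - 1) * dx u x t)) (dx u x t))
     (mult (p * Rpower (u x t) (p - 1)) (dxx u x t))); [exact D2|].
  unfold plus, mult; simpl. replace (p - 1 - 1) with (p - 2) by ring. ring.
Qed.

(* The choice [r = - R] is a reflection, which turns an upper bound on [v_x]
   into a lower bound. *)
Lemma rescaled_pressure_solution (p : R) (u : R -> R -> R) (x1 T r R : R) : 1 < p ->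
  positive_ancient_solution_PME p u -> T < 0 -> 0 < R -> r ^ 2 = R ^ 2 ->
  pressure_solution (p - 1)
    (fun x t => pressure p u (x1 + r * x) (T + R * t) / R)
    (fun x t => pressure_t p u (x1 + r * x) (T + R * t))
    (fun x t => r / R * pressure_x p u (x1 + r * x) (T + R * t))
    (fun x t => R * pressure_xx p u (x1 + r * x) (T + R * t)).
Proof.
  intros Hp Hu HT HR Hr.
  pose proof (positive_ancient_solution_PME_expand p u Hu) as Heq.
  destruct Hu as (Hreg & Hpos & _).
  (* Because [T < 0] strictly, even the final time [t = 0] of the rescaled box is an interior time
     of the solution, with a two-sided time derivative. *)
  assert (Hs : forall t, t <= 0 -> T + R * t < 0) by (intros; nra).
  assert (Dt : forall x t, t < 0 -> is_derive (fun s => pressure p u x s) t (pressure_t p u x t)).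
  { intros x t Ht. unfold pressure, pressure_t.
    replace (p * Rpower (u x t) (p - 2) * dt u x t)
      with (p / (p - 1) * ((p - 1) * Rpower (u x t) (p - 1 - 1) * dt u x t))
      by (replace (p - 1 - 1) with (p - 2) by ring; field; lra).
    apply is_derive_scal. apply (is_derive_Rpower_comp (fun s => u x s)); [apply Hpos, Ht|].
    exact (proj1 (C21_ancient_derivatives u x t Hreg Ht)). }
  assert (Dx : forall x t, t < 0 -> is_derive (fun y => pressure p u y t) x (pressure_x p u x t)).
  { intros x t Ht. unfold pressure, pressure_x.
    replace (p * Rpower (u x t) (p - 2) * dx u x t)
      with (p / (p - 1) * ((p - 1) * Rpower (u x t) (p - 1 - 1) * dx u x t))
      by (replace (p - 1 - 1) with (p - 2) by ring; field; lra).
    apply is_derive_scal. apply (is_derive_Rpower_comp (fun y => u y t)); [apply Hpos, Ht|].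
    exact (proj1 (proj2 (C21_ancient_derivatives u x t Hreg Ht))). }
  assert (Dxx : forall x t, t < 0 -> is_derive (fun y => pressure_x p u y t) x (pressure_xx p u x t)).
  { intros x t Ht. unfold pressure_x, pressure_xx.
    assert (D0 : is_derive (fun y => u y t) x (dx u x t)).
    { exact (proj1 (proj2 (C21_ancient_derivatives u x t Hreg Ht))). }
    assert (D1 : is_derive (fun y => dx u y t) x (dxx u x t)).
    { exact (proj2 (proj2 (C21_ancient_derivatives u x t Hreg Ht))). }
    pose proof (is_derive_Rpower_comp (fun y => u y t) (p - 2) x _ (Hpos x t Ht) D0) as D2.
    pose proof (is_derive_mult _ _ x _ _ (is_derive_scal _ x p _ D2) D1 Rmult_comm) as D3.
    replace (_ + _) with (plus (mult (p * ((p - 2) * Rpower (u x t) (p - 2 - 1) * dx u x t)) (dx u x t))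
       (mult (p * Rpower (u x t) (p - 2)) (dxx u x t))); [exact D3|].
    unfold plus, mult; simpl. replace (p - 2 - 1) with (p - 3) by ring. ring. }
  assert (CR : forall a x t, t < 0 -> continuous2 (fun y s => Rpower (u y s) a) x t).
  { intros a x t Ht. apply continuous2_Rpower; [apply Hpos, Ht|].
    exact (proj1 (C21_ancient_continuity u x t Hreg Ht)). }
  assert (Cv : forall x t, t < 0 -> continuous2 (pressure p u) x t).
  { intros x t Ht. apply continuous2_mult; [apply continuous2_const|apply CR, Ht]. }
  assert (Cdx : forall x t, t < 0 -> continuous2 (dx u) x t).
  { intros x t Ht. exact (proj1 (proj2 (C21_ancient_continuity u x t Hreg Ht))). }
  assert (Cx : forall x t, t < 0 -> continuous2 (pressure_x p u) x t).
  { intros x t Ht. apply continuous2_mult; [|apply Cdx, Ht].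
    apply continuous2_mult; [apply continuous2_const|apply CR, Ht]. }
  assert (Cxx : forall x t, t < 0 -> continuous2 (pressure_xx p u) x t).
  { intros x t Ht. apply continuous2_plus; apply continuous2_mult.
    - apply continuous2_mult; [apply continuous2_const|apply CR, Ht].
    - apply continuous2_mult; [apply Cdx, Ht|].
      apply continuous2_mult; [apply Cdx, Ht|apply continuous2_const].
    - apply continuous2_mult; [apply continuous2_const|apply CR, Ht].
    - exact (proj2 (proj2 (C21_ancient_continuity u x t Hreg Ht))). }
  split; intros x t Ht; specialize (Hs t Ht).
  - specialize (Dt (x1 + r * x) (T + R * t) Hs).
    auto_derive; [repeat split; eexists; eassumption|].
    rewrite (is_derive_unique (fun s : Rdefinitions.R => pressure p u (x1 + r * x) s) _ _ Dt). field; lra.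
  - specialize (Dx (x1 + r * x) (T + R * t) Hs).
    auto_derive; [repeat split; eexists; eassumption|].
    rewrite (is_derive_unique (fun s : Rdefinitions.R => pressure p u s (T + R * t)) _ _ Dx). field; lra.
  - specialize (Dxx (x1 + r * x) (T + R * t) Hs).
    auto_derive; [repeat split; eexists; eassumption|].
    rewrite (is_derive_unique (fun s : Rdefinitions.R => pressure_x p u s (T + R * t)) _ _ Dxx).
    transitivity (r ^ 2 / R * pressure_xx p u (x1 + r * x) (T + R * t)); [field; lra|].
    rewrite Hr. field; lra.
  - apply continuous2_mult; [apply continuous2_affine, Cv, Hs|apply continuous2_const].
  - apply continuous2_mult; [apply continuous2_const|apply continuous2_affine, Cx, Hs].
  - apply continuous2_mult; [apply continuous2_const|apply continuous2_affine, Cxx, Hs].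
  - apply Rdiv_lt_0_compat; [|exact HR]. apply Rmult_lt_0_compat; [apply Rdiv_lt_0_compat; lra|].
    apply exp_pos.
  - unfold pressure, pressure_t, pressure_x, pressure_xx. rewrite Heq by exact Hs.
    set (y := x1 + r * x). set (s := T + R * t). fold s in Hs.
    pose proof (Hpos y s Hs) as Hu.
    (* All powers of [u] are reduced to [A], the power [p - 3], so that the pressure equation
       becomes a rational identity. *)
    rewrite (Rpower_pred (u y s) (p - 1) Hu). replace (p - 1 - 1) with (p - 2) by ring.
    rewrite (Rpower_pred (u y s) (p - 2) Hu). replace (p - 2 - 1) with (p - 3) by ring.
    set (A := Rpower (u y s) (p - 3)).
    assert (E : (r / R * (p * (A * u y s) * dx u y s)) ^ 2 = (p * (A * u y s) * dx u y s) ^ 2).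
    { rewrite Rpow_mult_distr. replace ((r / R) ^ 2) with (r ^ 2 / R ^ 2) by (field; lra).
      rewrite Hr. field; lra. }
    rewrite E. field; lra.
Qed.

(** * The growth hypothesis and the conclusion *)

Lemma pressure_little_o (p x0 : R) (u : R -> R -> R) : 1 < p ->
  positive_ancient_solution_PME p u ->
  little_o_near_infinity x0 u
     (fun x t => rpow (Rabs (x - x0)) (1 / (p - 1)) + rpow (Rabs t) (1 / (p - 1))) ->
  forall d, 0 < d -> exists M, forall x t, t < 0 -> M < Rabs (x - x0) + Rabs t ->
    pressure p u x t <= d * (Rabs (x - x0) + Rabs t).
Proof.
  intros Hp (_ & Hpos & _) Hgr d Hd.
  (* Solves [p / (p - 1) * (2 * eps) ^ (p - 1) = d]; the 2 accounts for bounding each of the two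
     growth terms by the power of the sum. *)
  set (eps := Rpower (d * (p - 1) / p) (1 / (p - 1)) / 2).
  assert (Heps : 0 < eps) by (unfold eps; pose proof (exp_pos (1 / (p - 1) * ln (d * (p - 1) / p)));
    unfold Rpower; lra).
  destruct (Hgr eps Heps) as [M HM]. exists M. intros x t Ht HMx.
  specialize (HM x t Ht HMx). specialize (Hpos x t Ht).
  set (a := Rabs (x - x0)) in *. set (b := Rabs t) in *.
  assert (Ha : 0 <= a) by apply Rabs_pos.
  assert (Hb : 0 < b) by (apply Rabs_pos_lt; lra).
  assert (Hq : 0 < 1 / (p - 1)) by (apply Rdiv_lt_0_compat; lra).
  assert (Hrp : forall c, 0 <= c <= a + b -> 0 <= rpow c (1 / (p - 1)) <= Rpower (a + b) (1 / (p - 1))).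
  (* The case [c = 0] occurs at [x = x0], where [rpow] takes the value 0. *)
  { intros c Hc. unfold rpow. destruct (Rlt_dec 0 c).
    - split; [left; apply exp_pos|]. apply Rle_Rpower_l; lra.
    - split; [lra|left; apply exp_pos]. }
  pose proof (Hrp a ltac:(lra)) as Ra. pose proof (Hrp b ltac:(lra)) as Rb.
  rewrite (Rabs_pos_eq (u x t)), Rabs_pos_eq in HM by lra.
  assert (Hu : u x t <= Rpower (d * (p - 1) / p) (1 / (p - 1)) * Rpower (a + b) (1 / (p - 1))).
  { eapply Rle_trans; [exact HM|].
    apply Rle_trans with (eps * (2 * Rpower (a + b) (1 / (p - 1)))).
    - apply Rmult_le_compat_l; lra.
    - unfold eps. lra. }
  assert (Hdp : 0 < d * (p - 1) / p).
  { apply Rdiv_lt_0_compat; [apply Rmult_lt_0_compat|]; lra. }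
  rewrite Rpower_mult_distr in Hu by lra.
  assert (Hup : Rpower (u x t) (p - 1) <= d * (p - 1) / p * (a + b)).
  { eapply Rle_trans; [apply Rle_Rpower_l; [lra|split; [exact Hpos|exact Hu]]|].
    rewrite Rpower_mult. replace (1 / (p - 1) * (p - 1)) with 1 by (field; lra).
    rewrite Rpower_1; [lra|]. apply Rmult_lt_0_compat; lra. }
  unfold pressure.
  replace (d * (a + b)) with (p / (p - 1) * (d * (p - 1) / p * (a + b))) by (field; lra).
  apply Rmult_le_compat_l; [left; apply Rdiv_lt_0_compat; lra|exact Hup].
Qed.

(** The growth hypothesis is silent on a bounded set, but there [t <= T < 0] confines the points to
    a compact set on which the pressure is at most some [C]; taking [R >= C / d] absorbs it.
    Elsewhere the distance [Rabs (x - x0) + Rabs t] is at most [4 * R], whence the use of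
    [d / 4]. *)
Lemma pressure_small_on_large_box (p x0 x1 T : R) (u : R -> R -> R) : 1 < p ->
  positive_ancient_solution_PME p u ->
  little_o_near_infinity x0 u
     (fun x t => rpow (Rabs (x - x0)) (1 / (p - 1)) + rpow (Rabs t) (1 / (p - 1))) ->
  T < 0 -> forall d, 0 < d -> exists R, 0 < R /\
    forall x t, Rabs (x - x1) <= 2 * R -> T - R <= t <= T -> pressure p u x t <= d * R.
Proof.
  intros Hp Hu Hgr HT d Hd.
  destruct (pressure_little_o p x0 u Hp Hu Hgr (d / 4)) as [M HM]; [lra|].
  set (N := Rabs M + Rabs T).
  assert (HMN : M <= N) by (unfold N; pose proof (Rle_abs M); pose proof (Rabs_pos T); lra).
  assert (HTN : - N <= T).
  { unfold N. rewrite (Rabs_left T) by lra. pose proof (Rabs_pos M). lra. }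
  destruct (continuous2_bounded (pressure p u) (x0 - N) (x0 + N) (- N) T) as [C [HC BC]]; try lra.
  { intros x t Hx Ht. unfold pressure. apply continuous2_mult; [apply continuous2_const|].
    destruct Hu as (Hreg & Hpos & _).
    assert (Ht' : t < 0) by lra.
    apply continuous2_Rpower; [apply Hpos, Ht'|].
    exact (proj1 (C21_ancient_continuity u x t Hreg Ht')). }
  set (R := Rabs (x1 - x0) + Rabs T + C / d).
  assert (HCd : 0 <= C / d) by (apply Rdiv_le_0_compat; lra).
  pose proof (Rabs_pos (x1 - x0)). assert (0 < Rabs T) by (apply Rabs_pos_lt; lra).
  exists R. split; [unfold R; lra|]. intros x t Hx Ht.
  assert (HCR : C <= d * R).
  { replace C with (d * (C / d)) by (field; lra). apply Rmult_le_compat_l; unfold R; lra. }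
  destruct (Rle_lt_dec (Rabs (x - x0) + Rabs t) M) as [Hn|Hf].
  - eapply Rle_trans; [apply Rle_abs|]. eapply Rle_trans; [apply BC|exact HCR].
    + pose proof (Rabs_pos t). assert (Hxx : Rabs (x - x0) <= N) by lra.
      apply Rabs_le_between in Hxx. lra.
    + pose proof (Rabs_pos (x - x0)). assert (Htt : Rabs t <= N) by lra.
      apply Rabs_le_between in Htt. lra.
  - eapply Rle_trans; [apply HM; [lra|exact Hf]|].
    replace (d * R) with (d / 4 * (4 * R)) by field.
    apply Rmult_le_compat_l; [lra|].
    assert (Rabs (x - x0) <= 2 * R + Rabs (x1 - x0)).
    { replace (x - x0) with ((x - x1) + (x1 - x0)) by ring.
      eapply Rle_trans; [apply Rabs_triang|]. lra. }
    assert (Rabs t <= R + Rabs T).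
    { rewrite (Rabs_left t), (Rabs_left T) by lra. lra. }
    unfold R in *. lra.
Qed.

Lemma pressure_x_zero (p x0 : R) (u : R -> R -> R) : 1 < p ->
  positive_ancient_solution_PME p u ->
  little_o_near_infinity x0 u
     (fun x t => rpow (Rabs (x - x0)) (1 / (p - 1)) + rpow (Rabs t) (1 / (p - 1))) ->
  forall x t, t < 0 -> pressure_x p u x t = 0.
Proof.
  intros Hp Hu Hgr x t Ht.
  assert (Hl : forall l, 0 < l -> Rabs (pressure_x p u x t) <= 3 * l).
  { intros l Hl. set (m := p - 1). assert (Hm : 0 < m) by (unfold m; lra).
    set (k := 1 + 2 * m + (2 + 3 * m) * l).
    assert (Hk : 0 < k) by (unfold k; nra).
    (* The bound [d <= 1] removes [d] from the bracket of the smallness condition, which is then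
       implied by [16 * d * k <= l ^ 2]. *)
    set (d := Rmin 1 (l ^ 2 / (16 * k))).
    assert (Hl2 : 0 < l ^ 2) by (apply pow_lt; lra).
    assert (Hd : 0 < d) by (apply Rmin_pos; [lra|apply Rdiv_lt_0_compat; lra]).
    assert (Hd1 : d <= 1) by apply Rmin_l.
    assert (Hd2 : d <= l ^ 2 / (16 * k)) by apply Rmin_r.
    apply Rle_div_r in Hd2; [|lra].
    assert (Hdl : 16 * d * (1 + 2 * m * d + (2 + 3 * m) * l) <= l ^ 2).
    { apply Rle_trans with (d * (16 * k)); [|exact Hd2].
      replace (d * (16 * k)) with (16 * d * k) by ring.
      apply Rmult_le_compat_l; [lra|]. unfold k. nra. }
    destruct (pressure_small_on_large_box p x0 x t u Hp Hu Hgr Ht d Hd) as [R [HR Hbox]].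
    assert (Hside : forall r, Rabs r = R -> r / R * pressure_x p u x t <= 3 * l).
    { intros r Hr.
      assert (Hr2 : r ^ 2 = R ^ 2) by (rewrite <- Hr, pow2_abs; reflexivity).
      pose proof (unit_gradient_bound m d l _ _ _ _ Hm Hd Hl Hdl
        (rescaled_pressure_solution p u x t r R Hp Hu Ht HR Hr2)) as Hg.
      simpl in Hg. rewrite !Rmult_0_r, !Rplus_0_r in Hg. apply Hg.
      intros y s Hy Hs. apply Rle_div_l; [exact HR|]. apply Hbox; [|nra].
      replace (x + r * y - x) with (r * y) by ring. rewrite Rabs_mult, Hr.
      rewrite Rmult_comm. apply Rmult_le_compat_r; [lra|]. apply Rabs_le. lra. }
    apply Rabs_le. split.
    - pose proof (Hside (- R)) as H1. rewrite Rabs_Ropp, Rabs_pos_eq in H1 by lra.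
      specialize (H1 eq_refl). replace (- R / R) with (-1) in H1 by (field; lra). lra.
    - pose proof (Hside R) as H1. rewrite Rabs_pos_eq in H1 by lra.
      specialize (H1 eq_refl). replace (R / R) with 1 in H1 by (field; lra). lra. }
  destruct (Req_dec (pressure_x p u x t) 0) as [|Hne]; [assumption|exfalso].
  apply Rabs_pos_lt in Hne.
  (* This [l] bounds a positive number by half of itself. *)
  specialize (Hl (Rabs (pressure_x p u x t) / 6)). lra.
Qed.

(** Stated on a half-line to serve both variables: [b = 0] for time, and any [b] beyond the two
    points for space. *)
Lemma constant_of_derive_zero (f : R -> R) (b : R) :
  (forall x, x < b -> is_derive f x 0) -> forall x y, x < b -> y < b -> f x = f y.
Proof.
  intros Hf.
  assert (H : forall x y, x < y -> y < b -> f x = f y).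
  { intros x y Hxy Hy. apply (eq_is_derive f x y); [|exact Hxy].
    intros s Hs. apply Hf. lra. }
  intros x y Hx Hy. destruct (Rtotal_order x y) as [Hxy|[->|Hxy]].
  - apply H; assumption.
  - reflexivity.
  - symmetry. apply H; assumption.
Qed.

Theorem theorem1p5 (p : R) (hp : 1 < p) (x0 : R) (u : R -> R -> R)
  (hu : positive_ancient_solution_PME p u)
  (hgrowth : little_o_near_infinity x0 u
     (fun x t => rpow (Rabs (x - x0)) (1 / (p - 1))
                 + rpow (Rabs t) (1 / (p - 1)))) :
  exists c : R, forall x t : R, t < 0 -> u x t = c.
Proof.
  pose proof (pressure_x_zero p x0 u hp hu hgrowth) as Hvx.
  assert (Hux : forall x t, t < 0 -> dx u x t = 0).
  { intros x t Ht. specialize (Hvx x t Ht). unfold pressure_x in Hvx.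
    pose proof (exp_pos ((p - 2) * ln (u x t))) as HP. fold (Rpower (u x t) (p - 2)) in HP.
    apply Rmult_integral in Hvx. destruct Hvx as [Hvx|]; [|assumption].
    assert (0 < p * Rpower (u x t) (p - 2)) by (apply Rmult_lt_0_compat; lra). lra. }
  assert (Hut : forall x t, t < 0 -> dt u x t = 0).
  { intros x t Ht. rewrite (positive_ancient_solution_PME_expand p u hu x t Ht).
    assert (dxx u x t = 0) as ->.
    { unfold dxx, dx at 1. rewrite (Derive_ext _ (fun _ => 0)); [apply Derive_const|].
      intros y. apply Hux, Ht. }
    rewrite (Hux x t Ht). ring. }
  destruct hu as (Hreg & _).
  exists (u 0 (-1)). intros x t Ht.
  transitivity (u 0 t).
  - apply (constant_of_derive_zero (fun y => u y t) (Rmax x 0 + 1)).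
    + intros y _. rewrite <- (Hux y t Ht). exact (proj1 (proj2 (C21_ancient_derivatives u y t Hreg Ht))).
    + pose proof (Rmax_l x 0). lra.
    + pose proof (Rmax_r x 0). lra.
  - apply (constant_of_derive_zero (fun s => u 0 s) 0); [|lra|lra].
    intros s Hs. pose proof (proj1 (C21_ancient_derivatives u 0 s Hreg Hs)) as D.
    rewrite (Hut 0 s Hs) in D. exact D.
Qed.
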